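(* Let $p$ be a prime and $n\geq 3$ an integer. Let $\mathfrak{b}$ be an ideal of $P=\mathbb{Z}[x,y]/(p,x,y)^n$ for which there exists a homomorphism $\nu:\mathfrak{b}\to F_p$ such that $(\mathfrak{b},\nu)$ is a minimal generating pair. Denote by $B$ the ring $P/\mathfrak{b}$ and let $k=\dim_{F_p}\left(\operatorname{soc}(B)\cap\left((p)+(x,y)^2\right)\right)$. Then (i) $k\leq 3$; (ii) $k\leq\dim_{F_p}\operatorname{soc}(B)\leq k+2$; and (iii) $\left(\mathfrak{b}(p,x,y):(p,x,y)\right)=\mathfrak{b}$.
   Context: $F_p$ is the field with $p$ elements, and $\mathbb{Z}[x,y]$ is the commutative polynomial ring. For fixed $p$ and $n$, a pair $(\mathfrak{b},\nu)$ is called minimal generating if (1) $\mathfrak{b}$ is an ideal of $P=\mathbb{Z}[x,y]/(p,x,y)^n$ such that $(p,x,y)^{n-1}\subseteq\mathfrak{b}\subseteq(p)+(x,y)^2$; (2) $\nu:\mathfrak{b}\to F_p$ is a homomorphism of abelian groups satisfying $\nu|_{\mathfrak{b}(p,x,y)}=0$; and (3) for any element $u$ of the ideal $(p)+(x,y)^2$ of $P$ such that $u(p,x,y)\subseteq\mathfrak{b}$, either $u\in\mathfrak{b}$ or at least one of $\nu(pu),\nu(xu),\nu(yu)$ is nonzero. Here $\operatorname{soc}(B)=\operatorname{Ann}_B(p,x,y)$ is the socle of $B$, an $F_p$-vector space; in $\operatorname{soc}(B)\cap((p)+(x,y)^2)$ the symbol $(p)+(x,y)^2$ denotes the ideal of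 $B$ generated by $p,x^2,xy,y^2$. For ideals $I,J$ of $P$, $(I:J)=\{r\in P: rJ\subseteq I\}$. *)

(* Defs.v *)
From HB Require Import structures.
From mathcomp Require Import all_boot all_order all_algebra.
From mathcomp Require Import boolp classical_sets.
From mathcomp Require Import mpoly.

Set Implicit Arguments.
Unset Strict Implicit.
Unset Printing Implicit Defensive.

Import GRing.Theory.

Local Open Scope classical_set_scope.
Local Open Scope ring_scope.
Local Open Scope quotient_scope.

(* Ideals of a commutative ring, not necessarily proper (unlike the library's
   [idealr], which excludes the unit ideal). *)
Section Ideals.
Variable R : comNzRingType.
Implicit Types (I J S : set R) (n : nat).

Definition is_ideal I : Prop :=
  [/\ I 0, forall u v, I u -> I v -> I (u + v)
    & forall a u, I u -> I (a * u)].

Definition ideal_gen S : set R := smallest is_ideal S.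

Definition idealD I J : set R := [set u + v | u in I & v in J].

Definition idealM I J : set R := ideal_gen [set u * v | u in I & v in J].

Definition idealX I n : set R := iter n (idealM I) setT.

Definition idealColon I J : set R := [set r | forall s, J s -> I (r * s)].

Definition ann J : set R := [set r | forall s, J s -> r * s = 0].

Lemma ideal_gen_is_ideal S : is_ideal (ideal_gen S).
Proof.
split=> [A [[A0 _ _] _] //|u v hu hv A hA|a u hu A hA].
  by case: (hA) => -[_ AD _] _; apply: AD; [apply: hu|apply: hv].
by case: (hA) => -[_ _ AM] _; apply: AM; apply: hu.
Qed.

Lemma ideal_gen_min S I : is_ideal I -> S `<=` I -> ideal_gen S `<=` I.
Proof. by move=> hI SI u; apply. Qed.

Lemma idealX_is_ideal I n : is_ideal (idealX I n).
Proof. by case: n => [//|n]; apply: ideal_gen_is_ideal. Qed.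

Lemma idealX_sub I J n : is_ideal J -> I `<=` J -> (0 < n)%N ->
  idealX I n `<=` J.
Proof.
case: n => // n hJ IJ _; apply: ideal_gen_min => // _ [u Iu [v _ <-]].
by case: hJ => _ _ JM; rewrite mulrC; apply/JM/IJ.
Qed.

End Ideals.

(* [Fp_dim p S d]: S is an additive subgroup killed by p, hence an F_p-vector
   space, and it has an F_p-basis with d elements. A scalar c in F_p acts as
   multiplication by any natural number representing c. *)
Section Dimension.
Variables (p : nat) (V : zmodType).

Definition lincomb d (e : 'I_d -> V) (c : {ffun 'I_d -> 'F_p}) : V :=
  \sum_(i < d) e i *+ (c i : nat).

Definition Fp_basis (S : set V) d (e : 'I_d -> V) : Prop :=
  [/\ forall i, S (e i),
      forall c, lincomb e c = 0 -> forall i, c i = 0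
    & forall v, S v -> exists c, v = lincomb e c].

Definition Fp_subspace (S : set V) : Prop :=
  [/\ S 0, forall u v, S u -> S v -> S (u - v)
    & forall v, S v -> v *+ p = 0].

Definition Fp_dim (S : set V) (d : nat) : Prop :=
  Fp_subspace S /\ exists e : 'I_d -> V, Fp_basis S e.

Hypothesis p_pr : prime p.

Lemma lincombB (S : set V) d (e : 'I_d -> V) c c' :
  Fp_subspace S -> (forall i, S (e i)) ->
  lincomb e (c - c') = lincomb e c - lincomb e c'.
Proof.
move=> [_ _ Sp] Se; apply/eqP; rewrite eq_sym subr_eq; apply/eqP.
rewrite /lincomb -big_split; apply: eq_bigr => i _ /=.
have hmod m : e i *+ (m %% p) = e i *+ m.
  by rewrite [in RHS](divn_eq m p) mulrnDr mulnC mulrnA Sp// mul0rn add0r.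
have -> : c i = (c - c') i + c' i by rewrite !ffunE subrK.
rewrite -mulrnDr -[RHS]hmod; congr (_ *+ _).
by rewrite /= [X in (_ %% X)%N](Fp_cast p_pr).
Qed.

Lemma Fp_dim_unique (S : set V) d d' : Fp_dim S d -> Fp_dim S d' -> d = d'.
Proof.
have le m m' : Fp_dim S m -> Fp_dim S m' -> (m <= m')%N.
  move=> [hS [e [Se fe _]]] [_ [f [_ _ gf]]].
  have Sl c : S (lincomb e c).
    case: hS => S0 SB _.
    have SD u v : S u -> S v -> S (u + v).
      by move=> hu hv; rewrite -[v]opprK; apply: (SB) => //; rewrite -sub0r; apply: (SB).
    rewrite /lincomb; elim/big_ind: _ => // i _.
    by elim: (c i : nat) => [|k IH]; rewrite ?mulr0n// mulrS; apply: SD.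
  pose g c := projT1 (cid (gf _ (Sl c))).
  have gE c : lincomb e c = lincomb f (g c) by rewrite /g; case: cid.
  have g_inj : injective g.
    move=> c c' gcc'; apply/ffunP => i; apply/eqP; rewrite -subr_eq0.
    have := fe (c - c').
    rewrite (lincombB _ _ hS Se) gE gcc' -gE subrr => /(_ erefl i).
    by rewrite !ffunE => ->.
  have := leq_card g g_inj; rewrite !card_ffun !card_ord Fp_cast//.
  by rewrite leq_exp2l // prime_gt1.
by move=> h h'; apply/eqP; rewrite eqn_leq !le.
Qed.

End Dimension.

Notation Zxy := {mpoly int[2]}.

Definition Zx : Zxy := 'X_(@Ordinal 2 0 isT).
Definition Zy : Zxy := 'X_(@Ordinal 2 1 isT).

Definition pxy (R : comNzRingType) (p : nat) (x y : R) : set R :=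
  ideal_gen [set p%:R; x; y].

Definition p_xy2 (R : comNzRingType) (p : nat) (x y : R) : set R :=
  idealD (ideal_gen [set p%:R]) (idealX (ideal_gen [set x; y]) 2).

Section TruncatedRing.
Variables (p n : nat) (p_pr : prime p) (n_ge3 : (3 <= n)%N).

Definition eval0 (f : Zxy) : 'F_p := (f@_0%MM)%:~R.

Lemma ker_eval0_is_ideal : is_ideal [set f | eval0 f = 0].
Proof.
split=> [|u v /= u0 v0|a u /= u0]; rewrite /eval0 /=.
- by rewrite mcoeff0.
- by rewrite mcoeffD rmorphD /= -!/(eval0 _) u0 v0 addr0.
- by rewrite rmorphM rmorphM /= -[X in _ * X]/(eval0 u) u0 mulr0.
Qed.

Lemma pxy_ker : pxy p Zx Zy `<=` [set f | eval0 f = 0].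
Proof.
apply: ideal_gen_min; first exact: ker_eval0_is_ideal.
have X0 i : eval0 'X_i = 0 by rewrite /eval0 mcoeffX mnm1_eq0.
move=> f [[|]|] -> //=; rewrite ?X0 // /eval0.
by rewrite rmorph_nat rmorph_nat -(pchar_Fp_0 p_pr).
Qed.

Lemma eval01 : eval0 1 != 0.
Proof. by rewrite /eval0 mcoeff1 eqxx oner_neq0. Qed.

(* (p,x,y)^n; the hypotheses on p and n only serve to make it proper, as the
   library's ring quotients require. *)
Definition pxyX of prime p & (3 <= n)%N : Zxy -> bool :=
  fun f => f \in idealX (pxy p Zx Zy) n.

Lemma pxyX_closed : idealr_closed (pxyX p_pr n_ge3).
Proof.
have [h0 hD hM] := @idealX_is_ideal _ (pxy p Zx Zy) n.
split.
- exact/mem_set.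
- apply/negP => /set_mem /(idealX_sub ker_eval0_is_ideal pxy_ker (ltnW (ltnW n_ge3))) /= h.
  by move: eval01; rewrite h eqxx.
- by move=> a u v /set_mem hu /set_mem hv; apply/mem_set/hD => //; apply: hM.
Qed.

HB.instance Definition _ := isIdealr.Build Zxy (pxyX p_pr n_ge3) pxyX_closed.

Definition pxyX_idealr : idealr Zxy := pxyX p_pr n_ge3.

End TruncatedRing.

(* Z[x,y]/(p,x,y)^n *)
Notation truncZxy p_pr n_ge3 := {ideal_quot (pxyX_idealr p_pr n_ge3)}.

Section MinimalGenerating.
Variables (p n : nat) (p_pr : prime p) (n_ge3 : (3 <= n)%N).
Local Notation P := (truncZxy p_pr n_ge3).

Definition Px : P := \pi_P Zx.
Definition Py : P := \pi_P Zy.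

Definition Pmax : set P := pxy p Px Py.

(* The homomorphism nu : b -> F_p is a function on P; its values outside b are
   irrelevant, as everything below only evaluates it on elements of b. *)
Definition minimal_generating (b : set P) (nu : P -> 'F_p) : Prop :=
  [/\ is_ideal b,
      idealX Pmax n.-1 `<=` b /\ b `<=` p_xy2 p Px Py,
      forall u v, b u -> b v -> nu (u + v) = nu u + nu v,
      forall u, idealM b Pmax u -> nu u = 0
    & forall u, p_xy2 p Px Py u -> (forall m, Pmax m -> b (u * m)) ->
        b u \/ [\/ nu (p%:R * u) != 0, nu (Px * u) != 0 | nu (Py * u) != 0]].

(* A minimal generating ideal is proper, so quantifying over [idealr P] loses
   nothing. *)
Lemma minimal_generating_proper b nu : minimal_generating b nu -> ~ b 1.
Proof.
case=> _ [_ bsub] _ _ _ b1.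
pose K := [set r : P | eval0 p (repr r) = 0].
have [K0 KD KM] := ker_eval0_is_ideal p.
have KB u v : eval0 p u = 0 -> eval0 p (v - u) = 0 -> eval0 p v = 0.
  by move=> hu hv; rewrite -[v](subrK u); exact: (KD (v - u) u hv hu).
have piK f : eval0 p f = 0 <-> K (\pi_P f).
  have hI g : g \in pxyX p_pr n_ge3 -> eval0 p g = 0.
    move=> /set_mem hg.
    exact: (idealX_sub (ker_eval0_is_ideal p) (pxy_ker p_pr) (ltnW (ltnW n_ge3))) hg.
  split=> h; apply: (KB _ _ h); apply: hI; rewrite Quotient.idealrBE;
    by rewrite reprK.
have KI : is_ideal K.
  split.
  - by have /piK := K0; rewrite pi_zeror.
  - move=> u v hu hv; have /piK := KD _ _ hu hv.
    by rewrite rmorphD /= !reprK.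
  - move=> a u hu; have /piK := KM (repr a) _ hu.
    by rewrite rmorphM /= !reprK.
have KZ f : pxy p Zx Zy f -> K (\pi_P f) by move=> /(pxy_ker p_pr)/piK.
have Kg f : [set p%:R; Zx; Zy] f -> K (\pi_P f) by move=> h; apply: KZ => A [_]; apply.
have : K (\pi_P 1).
  rewrite rmorph1.
  have [u hu [v hv <-]] := bsub _ b1.
  case: KI (KI) => _ KD' _ KI; apply: KD'.
    apply: (ideal_gen_min KI _ hu) => _ ->.
    by rewrite -(rmorph_nat (\pi_P)); apply: Kg; left; left.
  apply: (idealX_sub KI _ _ hv) => //; apply: (ideal_gen_min KI) => _ [] ->.
    by apply: Kg; left; right.
  by apply: Kg; right.
by move=> /(piK _).2 h; move: (eval01 p); rewrite h eqxx.
Qed.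

Variable b : idealr P.

Definition Bx : {ideal_quot b} := \pi_{ideal_quot b} Px.
Definition By : {ideal_quot b} := \pi_{ideal_quot b} Py.

Definition soc : set {ideal_quot b} := ann (pxy p Bx By).

Definition soc_p_xy2 : set {ideal_quot b} :=
  soc `&` ideal_gen [set p%:R; Bx ^+ 2; Bx * By; By ^+ 2].

End MinimalGenerating.

Arguments Pmax {p n} p_pr n_ge3.
Arguments soc {p n p_pr n_ge3} b.
Arguments soc_p_xy2 {p n p_pr n_ge3} b.

(* Main.v *)
(** Reduce everything modulo p and record the order of vanishing in F_p[x,y]:
    since n >= 3, order at least 2 makes sense in P and cuts out exactly
    (p) + (x,y)^2.  On soc(B) inside (p) + (x,y)^2, the map
    u |-> (nu(pu), nu(xu), nu(yu)) to F_p^3 is well defined because nu kills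
    b(p,x,y), and injective by minimality; hence k <= 3.  If r(p,x,y) lies in b,
    then rx has order >= 2, so r has order >= 1; the coefficients of x and y then
    embed the quotient of soc(B) by its part in (p) + (x,y)^2 into F_p^2.
    Finally, if r(p,x,y) lies in b(p,x,y), then rx has order >= 3, so r has order
    >= 2, i.e. r is in (p) + (x,y)^2, while nu(pr) = nu(xr) = nu(yr) = 0; minimality
    gives r in b. *)

Require Import Defs.
From HB Require Import structures.
From mathcomp Require Import all_boot all_order all_algebra.
From mathcomp Require Import boolp classical_sets.
From mathcomp Require Import mpoly.

Set Implicit Arguments.
Unset Strict Implicit.
Unset Printing Implicit Defensive.

Import GRing.Theory.

Local Open Scope classical_set_scope.
Local Open Scope ring_scope.
Local Open Scope quotient_scope.

(** * Dimension of an F_p-space from the common kernel of finitely many functionals *)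

Section DimensionFunctionals.
Variables (p : nat) (V : zmodType).
Implicit Type T : set V.

Lemma Fp_subspaceD T u v : Fp_subspace p T -> T u -> T v -> T (u + v).
Proof.
by move=> [T0 TB _] Tu Tv; rewrite -[v]opprK; apply: (TB) => //; rewrite -sub0r; apply: TB.
Qed.

Lemma Fp_subspaceMn T u m : Fp_subspace p T -> T u -> T (u *+ m).
Proof.
move=> hT Tu; elim: m => [|m IH]; first by rewrite mulr0n; case: hT.
by rewrite mulrS; apply: Fp_subspaceD.
Qed.

(** Additivity is asked on [T] only, because [nu] is controlled only on [b]. *)
Definition additive_on T (l : V -> 'F_p) : Prop :=
  forall u v, T u -> T v -> l (u + v) = l u + l v.

Lemma additive_on0 T l : Fp_subspace p T -> additive_on T l -> l 0 = 0.
Proof.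
by move=> [T0 _ _] lD; apply: (@addrI _ (l 0)); rewrite -lD // !addr0.
Qed.

Lemma additive_onMn T l u m : Fp_subspace p T -> additive_on T l -> T u ->
  l (u *+ m) = l u *+ m.
Proof.
move=> hT lD Tu; elim: m => [|m IH]; first by rewrite !mulr0n (additive_on0 hT).
by rewrite !mulrS lD ?IH //; apply: Fp_subspaceMn.
Qed.

Lemma additive_onB T l u v : Fp_subspace p T -> additive_on T l -> T u -> T v ->
  l (u - v) = l u - l v.
Proof.
move=> hT lD Tu Tv; apply: (@addIr _ (l v)); rewrite subrK -lD ?subrK //.
by case: hT => _ TB _; apply: TB.
Qed.

Lemma Fp_subspace_ker T l : Fp_subspace p T -> additive_on T l ->
  Fp_subspace p (T `&` [set v | l v = 0]).
Proof.
move=> hT lD; have [T0 TB Tp] := hT; split=> [|u v [Tu lu] [Tv lv]|v [Tv _]].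
- by split; rewrite //= (additive_on0 hT).
- by split; [apply: TB|rewrite /= (additive_onB hT) //= lu lv subrr].
- exact: Tp.
Qed.

(** If [l] vanishes on [T], the kernel is all of [T]; otherwise any [t] in [T] with [l t != 0]
    extends a basis of the kernel to one of [T]. *)
Lemma Fp_dim_ker1 T l k : Fp_subspace p T -> additive_on T l ->
  Fp_dim p (T `&` [set v | l v = 0]) k ->
  exists2 s, Fp_dim p T s & (k <= s <= k.+1)%N.
Proof.
move=> hT lD hk.
have [[t Tt lt]|lT] := pselect (exists2 t, T t & l t != 0); last first.
  exists k; rewrite ?leqnn ?leqnSn //.
  suff <- : T `&` [set v | l v = 0] = T by [].
  apply/seteqP; split=> [v []//|v Tv]; split=> //=.
  by apply/eqP/negPn/negP => lv; apply: lT; exists v.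
exists k.+1; rewrite ?leqnn ?leqnSn //; split=> //.
have [hK [e [Ke fe ge]]] := hk.
pose e' (i : 'I_k.+1) := if unlift ord0 i is Some j then e j else t.
have e'E (c : {ffun 'I_k.+1 -> 'F_p}) : lincomb e' c = t *+ (c ord0 : nat)
    + lincomb e [ffun j => c (lift ord0 j)].
  rewrite /lincomb big_ord_recl /e' unlift_none; congr (_ + _).
  by apply: eq_bigr => j _; rewrite liftK ffunE.
have Kl (c : {ffun 'I_k -> 'F_p}) : (T `&` [set v | l v = 0]) (lincomb e c).
  rewrite /lincomb; elim/big_ind: _ => [|u v|i _]; first by case: hK.
    exact: Fp_subspaceD.
  exact: Fp_subspaceMn.
exists e'; split=> [i|c|v Tv].
- by rewrite /e'; case: unliftP => // j _; case: (Ke j).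
- rewrite e'E => h.
  (* Applying [l] to the relation removes the kernel part and leaves [l t] times the coefficient of
     [t]. *)
  have [Tl ll] := Kl [ffun j => c (lift ord0 j)].
  have c0 : c ord0 = 0.
    move: (congr1 l h); rewrite lD ?(additive_on0 hT) //; last exact: Fp_subspaceMn.
    rewrite ll addr0 (additive_onMn _ hT) // -mulr_natr natr_Zp => /eqP.
    by rewrite mulf_eq0 (negPf lt) => /eqP.
  move=> i; case: (unliftP ord0 i) => [j ->|-> //].
  move: h; rewrite c0 mulr0n add0r => /fe /(_ j).
  by rewrite ffunE.
(* This [a] is the scalar for which [v - a t] falls into the kernel of [l]. *)
- pose a : 'F_p := l v / l t.
  have lta : l t *+ (a : nat) = l v.
    by rewrite -mulr_natr natr_Zp /a mulrC divfK.
  have Ta : T (t *+ (a : nat)) by exact: Fp_subspaceMn.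
  have /ge [c hc] : (T `&` [set v | l v = 0]) (v - t *+ (a : nat)).
    split; first by case: hT => _ TB _; apply: TB.
    by rewrite /= (additive_onB hT) // (additive_onMn _ hT) // lta subrr.
  exists [ffun i => if unlift ord0 i is Some j then c j else a].
  rewrite e'E ffunE unlift_none -[LHS](subrK (t *+ (a : nat))) addrC hc.
  by congr (_ + lincomb e _); apply/ffunP => j; rewrite !ffunE liftK.
Qed.

(** Each functional raises the dimension by at most one: the induction hypothesis treats the last
    [d] functionals on the kernel of the first, and [Fp_dim_ker1] restores the first. Finite
    dimension of [T] is a conclusion. *)
Lemma Fp_dim_ker T d (l : 'I_d -> V -> 'F_p) k :
  Fp_subspace p T -> (forall i, additive_on T (l i)) ->
  Fp_dim p (T `&` [set v | forall i, l i v = 0]) k ->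
  exists2 s, Fp_dim p T s & (k <= s <= k + d)%N.
Proof.
elim: d T l => [|d IH] T l hT lD hk.
  exists k; rewrite ?addn0 ?leqnn //.
  suff <- : T `&` [set v | forall i, l i v = 0] = T by [].
  by apply/seteqP; split=> [v []//|v Tv]; split=> // -[].
have [|||s hs /andP[ks sk]] :=
    IH (T `&` [set v | l ord0 v = 0]) (fun i => l (lift ord0 i)).
- exact: Fp_subspace_ker.
- by move=> i u v [Tu _] [Tv _]; apply: lD.
- suff <- : T `&` [set v | forall i, l i v = 0] = T `&` [set v | l ord0 v = 0]
      `&` [set v | forall i, l (lift ord0 i) v = 0] by [].
  apply/seteqP; split=> v /=; first by move=> [Tv lv].
  by move=> [[Tv lv0] lv]; split=> // i; case: (unliftP ord0 i) => [j ->|->].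
have [s' hs' /andP[ss' s's]] := Fp_dim_ker1 hT (lD _) hs.
exists s' => //; rewrite (leq_trans ks ss') addnS.
by rewrite (leq_trans s's).
Qed.

Lemma Fp_dim0 : Fp_dim p [set 0 : V] 0.
Proof.
split; first by split=> // [u v -> ->|v ->]; rewrite ?subrr ?mul0rn.
exists (fun=> 0); split=> [[]//|c _ []//|v ->].
by exists 0; rewrite /lincomb big_ord0.
Qed.

End DimensionFunctionals.

(** * Ideals under ring morphisms, and generators of (p) + (x,y)^2 *)

Section IdealFacts.
Variables (R S : comNzRingType) (phi : {rmorphism R -> S}).

Lemma sub_ideal_gen (A : set R) : A `<=` ideal_gen A.
Proof. by move=> u Au I [_]; apply. Qed.

Lemma is_idealN (I : set R) u : is_ideal I -> I u -> I (- u).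
Proof. by case=> _ _ IM Iu; rewrite -mulN1r; apply: IM. Qed.

Lemma is_idealB (I : set R) u v : is_ideal I -> I u -> I v -> I (u - v).
Proof. by move=> hI Iu Iv; case: (hI) => _ ID _; apply: ID (is_idealN hI Iv). Qed.

Lemma is_ideal_preimage (I : set S) : is_ideal I -> is_ideal (phi @^-1` I).
Proof.
case=> I0 ID IM; split=> [|u v|a u] /=; rewrite ?rmorph0 ?rmorphD ?rmorphM //.
  exact: ID.
exact: IM.
Qed.

Lemma is_ideal_image (I : set R) : (forall v, exists u, phi u = v) ->
  is_ideal I -> is_ideal (phi @` I).
Proof.
move=> surj [I0 ID IM]; split.
- by exists 0; rewrite ?rmorph0.
- by move=> _ _ [u Iu <-] [v Iv <-]; exists (u + v); rewrite ?rmorphD //; apply: ID.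
- move=> a _ [u Iu <-]; have [c <-] := surj a.
  by exists (c * u); rewrite ?rmorphM //; apply: IM.
Qed.

(** An ideal containing the kernel is saturated, so membership can be tested after applying
    [phi]. *)
Lemma image_ideal_ker (I : set R) u : is_ideal I ->
  (forall v, phi v = 0 -> I v) -> (phi @` I) (phi u) -> I u.
Proof.
move=> hI kerI [v Iv uv]; rewrite -[u](subrK v); case: (hI) => _ ID _.
by apply: ID => //; apply: kerI; rewrite rmorphB uv subrr.
Qed.

Lemma idealD_is_ideal (I J : set R) : is_ideal I -> is_ideal J ->
  is_ideal (idealD I J).
Proof.
move=> [I0 ID IM] [J0 JD JM]; split.
- by exists 0 => //; exists 0; rewrite ?addr0.
- move=> _ _ [u Iu [v Jv <-]] [u' Iu' [v' Jv' <-]].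
  by exists (u + u'); [exact: ID|exists (v + v'); [exact: JD|rewrite addrACA]].
- move=> a _ [u Iu [v Jv <-]]; exists (a * u); first exact: IM.
  by exists (a * v); [exact: JM|rewrite mulrDr].
Qed.

Lemma p_xy2_is_ideal p (x y : R) : is_ideal (p_xy2 p x y).
Proof. exact: idealD_is_ideal (ideal_gen_is_ideal _) (idealX_is_ideal _ _). Qed.

Lemma p_xy2_gen p (x y : R) :
  [set p%:R; x ^+ 2; x * y; y ^+ 2] `<=` p_xy2 p x y.
Proof.
have E u v : [set x; y] u -> [set x; y] v -> p_xy2 p x y (u * v).
  move=> hu hv; exists 0; first by case: (ideal_gen_is_ideal [set p%:R : R]).
  exists (u * v); rewrite ?add0r //; apply: sub_ideal_gen.
  exists u; first exact: sub_ideal_gen.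
  exists v => //; apply: sub_ideal_gen.
  (* The square of an ideal [I] unfolds to [I * (I * setT)], so [v] is written as [v * 1]. *)
  by exists v; [exact: sub_ideal_gen|exists 1; rewrite ?mulr1].
move=> _ [[[->|->]|->]|->]; rewrite ?expr2; do ?[by apply: E; [left|left]];
  do ?[by apply: E; [right|right]]; do ?[by apply: E; [left|right]].
exists p%:R; first exact: sub_ideal_gen.
by exists 0; rewrite ?addr0 //; case: (idealX_is_ideal (ideal_gen [set x; y]) 2).
Qed.

End IdealFacts.

(** * Order of vanishing modulo p in Z[x,y] *)

Section CoefficientsModp.
Variable p : nat.
Hypothesis p_pr : prime p.

Definition coef_modp (m : 'X_{1..2}) (f : Zxy) : 'F_p := (f@_m)%:~R.

(* The reduction of f modulo p has order at least d at the origin of F_p[x,y]. *)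
Definition ord_ge d : set Zxy :=
  [set f | forall m, (mdeg m < d)%N -> coef_modp m f = 0].

Lemma coef_modpD m : {morph coef_modp m : f g / f + g}.
Proof. by move=> f g; rewrite /coef_modp mcoeffD rmorphD. Qed.

Lemma ord_geM d e f g : ord_ge d f -> ord_ge e g -> ord_ge (d + e) (f * g).
Proof.
move=> fd ge m md; rewrite /coef_modp mcoeffM rmorph_sum big1 // => k /eqP mk.
rewrite rmorphM /= -/(coef_modp _ f) -/(coef_modp _ g).
have [kd|dk] := ltnP (mdeg k.1) d; first by rewrite fd ?mul0r.
(* The degrees add up to less than [d + e], so if the first is at least [d], the second is below
   [e]. *)
rewrite (ge k.2) ?mulr0 // -(ltn_add2l d); apply: leq_ltn_trans md.
by rewrite (leq_trans _ (eq_leq (esym (etrans (congr1 mdeg mk) (mdegD _ _))))) ?leq_add2r.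
Qed.

Lemma ord_ge_is_ideal d : is_ideal (ord_ge d).
Proof.
split=> [m _|f g fd gd m md|a f fd]; first by rewrite /coef_modp mcoeff0.
  by rewrite coef_modpD fd // gd // addr0.
(* Every polynomial has order at least 0. *)
by rewrite -[d]add0n; apply: ord_geM.
Qed.

Lemma ord_geW d e : (e <= d)%N -> ord_ge d `<=` ord_ge e.
Proof. by move=> ed f fd m me; apply: fd; apply: leq_trans ed. Qed.

Lemma ord_ge_p d : ord_ge d p%:R.
Proof.
move=> m _; rewrite /coef_modp -mpolyC_nat mcoeffC rmorphM rmorph_nat /=.
by rewrite pchar_Fp_0 ?mul0r.
Qed.

Lemma ord_geX i : ord_ge 1 'X_i.
Proof.
move=> m; rewrite ltnS leqn0 mdeg_eq0 => /eqP ->.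
by rewrite /coef_modp mcoeffX mnm1_eq0.
Qed.

(** Multiplication by a variable shifts coefficients without changing them, so it can be cancelled
    at the cost of one order. *)
Lemma ord_geXM d i f : ord_ge d.+1 ('X_i * f) -> ord_ge d f.
Proof.
move=> fd m md; rewrite /coef_modp -(mcoeffMX f U_(i)) mulrC.
by apply: fd; rewrite mdegD mdeg1.
Qed.

Lemma pxy_ord_ge1 : pxy p Zx Zy `<=` ord_ge 1.
Proof.
apply: (ideal_gen_min (ord_ge_is_ideal 1)) => _ [[->|->]|->].
- exact: ord_ge_p.
- exact: ord_geX.
- exact: ord_geX.
Qed.

(** For [d >= 2] the inclusion is strict, since p itself has every order. *)
Lemma pxyX_ord_ge d : idealX (pxy p Zx Zy) d `<=` ord_ge d.
Proof.
elim: d => [|d IH] //; apply: (ideal_gen_min (ord_ge_is_ideal _)).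
by move=> _ [u /pxy_ord_ge1 u1 [v /IH vd <-]]; rewrite -add1n; apply: ord_geM.
Qed.

Lemma ord_ge2P f : ord_ge 1 f -> (forall i, coef_modp U_(i) f = 0) -> ord_ge 2 f.
Proof.
move=> f1 fX m; rewrite leq_eqVlt => /orP[|/f1 //].
by rewrite eqSS => /mdeg1P [i /eqP ->].
Qed.

(** Term by term: below degree 2 the coefficient is a multiple of p, and from degree 2 on the
    monomial is a multiple of x^2, xy or y^2. *)
Lemma ord_ge2_sub (I : set Zxy) : is_ideal I ->
  [set p%:R; Zx ^+ 2; Zx * Zy; Zy ^+ 2] `<=` I -> ord_ge 2 `<=` I.
Proof.
move=> [I0 ID IM] Igen f f2; rewrite [f]mpolyE.
elim/big_ind: _ => [//|//|m _]; rewrite -mul_mpolyC.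
have [/f2 fm|m2] := ltnP (mdeg m) 2.
  have : (p %| f@_m)%Z by rewrite (intdiv.dvdz_pcharf (pchar_Fp p_pr)); apply/eqP.
  case/intdiv.dvdzP => c ->; rewrite mpolyCM mulrAC; apply: IM.
  by rewrite -natz mpolyC_nat; apply: Igen; do 3 left.
apply: (IM); move: m2; rewrite mpolyXE_id mdegE !big_ord_recl !big_ord0.
have -> : lift ord0 ord0 = @Ordinal 2 1 isT by apply: val_inj.
have -> : ord0 = @Ordinal 2 0 isT by apply: val_inj.
rewrite mulr1 addn0 -/Zx -/Zy.
(* Six shapes of the exponent pair remain, (0,j+2), (1,1), (1,j+2), (i+2,0), (i+2,1) and (i+2,j+2);
   each exhibits a quadratic factor. *)
case: (m _) => [|[|i]]; case: (m _) => [|[|j]] // _.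
- by rewrite -[j.+2]addn2 exprD mulrA; apply: (IM); apply: Igen; right.
- by rewrite !expr1; apply: Igen; left; right.
- by rewrite -[j.+2]addn1 exprD mulrCA !expr1; apply: (IM); apply: Igen; left; right.
- by rewrite -[i.+2]addn2 exprD expr0 mulr1; apply: (IM); apply: Igen; left; left; right.
- by rewrite -[i.+2]addn2 exprD mulrAC; apply: (IM); apply: Igen; left; left; right.
- by rewrite -[i.+2]addn2 exprD mulrAC; apply: (IM); apply: Igen; left; left; right.
Qed.

End CoefficientsModp.

(** * The order of vanishing on P *)

Section TruncatedOrder.
Variables (p n : nat) (p_pr : prime p) (n_ge3 : (3 <= n)%N).
Local Notation P := (truncZxy p_pr n_ge3).
Local Notation Px := (Px p_pr n_ge3).
Local Notation Py := (Py p_pr n_ge3).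
Local Notation Pmax := (Pmax p_pr n_ge3).
Implicit Types (f : Zxy) (u v : P).

Definition Pord_ge d : set P := \pi_P @` ord_ge p d.

Lemma piP_surj u : exists f, \pi_P f = u.
Proof. by exists (repr u); rewrite reprK. Qed.

Lemma Pord_ge_is_ideal d : is_ideal (Pord_ge d).
Proof. exact: is_ideal_image piP_surj (ord_ge_is_ideal p d). Qed.

(** Two lifts differ by an element of (p,x,y)^n, which has order at least n; hence for [d <= n] the
    bound holds for every lift, not just for some lift. *)
Lemma Pord_ge_pi d f : (d <= n)%N -> Pord_ge d (\pi_P f) -> ord_ge p d f.
Proof.
move=> dn; apply: image_ideal_ker (ord_ge_is_ideal p d) _ => g.
rewrite -(rmorph0 \pi_P) => /eqP; rewrite -Quotient.idealrBE subr0.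
by move=> /set_mem /(pxyX_ord_ge p_pr) /(ord_geW dn).
Qed.

Lemma Pord_geM d e u v : Pord_ge d u -> Pord_ge e v -> Pord_ge (d + e) (u * v).
Proof.
by move=> [f fd <-] [g ge <-]; exists (f * g); rewrite ?rmorphM //; apply: ord_geM.
Qed.

Lemma Pord_ge_p d : Pord_ge d p%:R.
Proof. by exists p%:R; rewrite ?rmorph_nat //; apply: ord_ge_p. Qed.

Lemma Pmax_Pord_ge : Pmax `<=` Pord_ge 1.
Proof.
apply: (ideal_gen_min (Pord_ge_is_ideal 1)) => _ [[->|->]|->].
- exact: Pord_ge_p.
- by exists Zx => //; apply: ord_geX.
- by exists Zy => //; apply: ord_geX.
Qed.

Lemma Pord_geXM d u : (d < n)%N -> Pord_ge d.+1 (u * Px) -> Pord_ge d u.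
Proof.
have [f <-] := piP_surj u => dn; rewrite -rmorphM mulrC => /(Pord_ge_pi dn) /ord_geXM h.
by exists f.
Qed.

(** This turns the ideal in the minimality condition into a condition on coefficients. One inclusion
    is checked on generators, the other is [ord_ge2_sub] applied to the preimage ideal in Z[x,y]. *)
Lemma p_xy2E : p_xy2 p Px Py = Pord_ge 2.
Proof.
apply/seteqP; split.
  move=> _ [u up [v vxy <-]]; have [_ ID _] := Pord_ge_is_ideal 2; apply: ID.
    apply: (ideal_gen_min (Pord_ge_is_ideal 2)) up => _ ->; exact: Pord_ge_p.
  have xy1 : ideal_gen [set Px; Py] `<=` Pord_ge 1.
    apply: ideal_gen_min (Pord_ge_is_ideal 1) _ => _ [->|->].
      by exists Zx => //; apply: ord_geX.
    by exists Zy => //; apply: ord_geX.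
  apply: (ideal_gen_min (Pord_ge_is_ideal 2)) vxy => _ [a /xy1 a1 [c cxy <-]].
  apply: (@Pord_geM 1 1) => //.
  by apply: (idealX_sub (Pord_ge_is_ideal 1) xy1 (n := 1)).
move=> _ [f f2 <-].
have hI := @is_ideal_preimage Zxy P \pi_P _ (p_xy2_is_ideal p Px Py).
apply: (ord_ge2_sub p_pr hI _ f2) => g hg; apply: (p_xy2_gen (p := p)).
case: hg => [[[->|->]|->]|->]; rewrite ?rmorph_nat ?rmorphXn ?rmorphM.
- by do 3 left.
- by left; left; right.
- by left; right.
- by right.
Qed.

End TruncatedOrder.

(** * The socle of B and the three conclusions *)

Section SocleOfQuotient.
Variables (p n : nat) (p_pr : prime p) (n_ge3 : (3 <= n)%N).
Local Notation P := (truncZxy p_pr n_ge3).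
Local Notation Px := (Px p_pr n_ge3).
Local Notation Py := (Py p_pr n_ge3).
Local Notation Pmax := (Pmax p_pr n_ge3).
Local Notation Pord_ge := (@Pord_ge p n p_pr n_ge3).
Variable b : idealr P.
Local Notation B := {ideal_quot b}.
Hypothesis b_ord : [set` b] `<=` Pord_ge 2.
Implicit Types (u : P) (v : B).

Lemma idealr_is_ideal : is_ideal [set` b].
Proof.
split=> [|u w|a u] /=; first exact: rpred0.
  exact: rpredD.
exact: idealMr.
Qed.

Lemma piB_eq0 u : \pi_B u = 0 <-> [set` b] u.
Proof.
rewrite -(rmorph0 \pi_B) /= -[in X in _ <-> X](subr0 u) Quotient.idealrBE.
by split=> [->|/eqP].
Qed.

Lemma piB_surj v : exists u, \pi_B u = v.
Proof. by exists (repr v); rewrite reprK. Qed.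

(** Indexing the generators makes nu(pu), nu(xu), nu(yu) one family over ['I_3], as [Fp_dim_ker]
    expects. *)
Definition gens : seq P := [:: p%:R; Px; Py].

Lemma gens_Pmax (i : 'I_3) : Pmax gens`_i.
Proof.
apply: sub_ideal_gen; case: i => [[|[|[|]]]] //= _; [by left; left|by left; right|by right].
Qed.

(** Annihilation need only be tested on the generators p, x, y, which correspond under the
    projection from P to B. *)
Lemma socP u : soc b (\pi_B u) <-> (forall m, Pmax m -> [set` b] (u * m)).
Proof.
split=> [hu|hu].
  have Ku : is_ideal [set m | [set` b] (u * m)].
    have [b0 bD bM] := idealr_is_ideal; split=> [|m m' hm hm'|a m hm] /=.
    - by rewrite mulr0.
    - by rewrite mulrDr; apply: bD.
    - by rewrite mulrCA; apply: bM.
  apply: (ideal_gen_min Ku) => m hm; apply/piB_eq0; rewrite rmorphM /=.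
  apply: hu; apply: sub_ideal_gen; case: hm => [[->|->]|->].
  - by left; left; rewrite rmorph_nat.
  - by left; right.
  - by right.
have Ku : is_ideal [set w : B | \pi_B u * w = 0].
  split=> [|w w' hw hw'|a w hw] /=; first by rewrite mulr0.
    by rewrite mulrDr hw hw' addr0.
  by rewrite mulrCA hw mulr0.
apply: (ideal_gen_min Ku) => w hw /=.
have [m Pm ->] : exists2 m, Pmax m & w = \pi_B m.
  case: hw => [[->|->]|->].
  - by exists p%:R; rewrite ?rmorph_nat //; apply: (gens_Pmax ord0).
  - by exists Px => //; apply: (gens_Pmax (@Ordinal 3 1 isT)).
  - by exists Py => //; apply: (gens_Pmax (@Ordinal 3 2 isT)).
by rewrite -rmorphM; apply/piB_eq0/hu.
Qed.

Lemma soc_subspace : Fp_subspace p (soc b).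
Proof.
split=> [s _|u v hu hv s hs|v hv]; first by rewrite mul0r.
  by rewrite mulrBl hu // hv // subrr.
by rewrite -mulr_natr; apply: hv; apply: sub_ideal_gen; left; left.
Qed.

Lemma soc_p_xy2_subspace : Fp_subspace p (soc_p_xy2 b).
Proof.
have [s0 sB sp] := soc_subspace.
have hI := ideal_gen_is_ideal [set p%:R; Bx b ^+ 2; Bx b * By b; By b ^+ 2].
split=> [|u v [su gu] [sv gv]|v [sv _]].
- by split=> //; case: hI.
- by split; [exact: sB|exact: (is_idealB hI gu gv)].
- exact: sp.
Qed.

(** Since [b] lies in order at least 2 and [2 <= n], passing to B does not blur the distinction
    between order at least 2 and lower order. *)
Lemma gen_p_xy2P f : ideal_gen [set p%:R; Bx b ^+ 2; Bx b * By b; By b ^+ 2]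
  (\pi_B (\pi_P f)) <-> ord_ge p 2 f.
Proof.
have gP : [set p%:R; Zx ^+ 2; Zx * Zy; Zy ^+ 2] `<=`
    [set g | [set p%:R; Bx b ^+ 2; Bx b * By b; By b ^+ 2] (\pi_B (\pi_P g))].
  move=> g hg; case: hg => [[[->|->]|->]|->] /=.
  - by do 3 left; rewrite !rmorph_nat.
  - by left; left; right; rewrite !rmorphXn.
  - by left; right; rewrite !rmorphM.
  - by right; rewrite !rmorphXn.
have hI := ideal_gen_is_ideal [set p%:R; Bx b ^+ 2; Bx b * By b; By b ^+ 2].
split=> [hf|].
  apply: (@Pord_ge_pi _ _ p_pr n_ge3); first exact: ltnW.
  have K2 := Pord_ge_is_ideal p_pr n_ge3 2.
  apply: (@image_ideal_ker P B \pi_B _ _ K2) => [u /piB_eq0 /b_ord //|].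
  have K := is_ideal_image piB_surj K2.
  apply: (ideal_gen_min K) hf => w hw.
  have hx : ord_ge p 1 Zx by exact: ord_geX.
  have hy : ord_ge p 1 Zy by exact: ord_geX.
  have [g g2 <-] : exists2 g, ord_ge p 2 g & \pi_B (\pi_P g) = w.
    case: hw => [[[->|->]|->]|->].
    - by exists p%:R; [exact: ord_ge_p|rewrite /= !rmorph_nat].
    - by exists (Zx ^+ 2); [exact: (ord_geM (d := 1))|rewrite /= !rmorphXn].
    - by exists (Zx * Zy); [exact: (ord_geM (d := 1))|rewrite /= !rmorphM].
    - by exists (Zy ^+ 2); [exact: (ord_geM (d := 1))|rewrite /= !rmorphXn].
  by exists (\pi_P g) => //; exists g.
have hI' := @is_ideal_preimage Zxy P \pi_P _ (@is_ideal_preimage P B \pi_B _ hI).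
move=> f2; apply: (ord_ge2_sub p_pr hI' _ f2) => g /gP hg.
exact: (sub_ideal_gen (A := [set p%:R; _; _; _]) hg).
Qed.

(** An arbitrary choice of polynomial; its coefficients modulo p in degrees 0 and 1 do not depend on
    the choice, by [b_ord]. *)
Definition lift v : Zxy := repr (repr v).

Lemma liftK v : \pi_B (\pi_P (lift v)) = v.
Proof. by rewrite !reprK. Qed.

(** The product with x lies in [b], hence has order at least 2, and x is cancelled. *)
Lemma soc_lift_ord_ge1 v : soc b v -> ord_ge p 1 (lift v).
Proof.
rewrite -{1}[v]liftK => /socP sv; have n_gt1 := ltnW n_ge3.
have /b_ord /(Pord_geXM n_gt1) := sv _ (gens_Pmax (@Ordinal 3 1 isT)).
by move/Pord_ge_pi; apply; apply: ltnW.
Qed.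

Lemma coef_modp_liftD i : additive_on (soc b) (fun v => coef_modp p U_(i) (lift v)).
Proof.
move=> v w _ _; rewrite -[lift (v + w)](subrK (lift v + lift w)).
(* [lift] is not additive, but its defect [d] maps to 0 in B, so it has no linear coefficient modulo
   p. *)
set d := _ - _; have d2 : ord_ge p 2 d.
  apply/gen_p_xy2P; rewrite /d !(rmorphB, rmorphD) /= !liftK subrr.
  by case: (ideal_gen_is_ideal [set p%:R; Bx b ^+ 2; Bx b * By b; By b ^+ 2]).
by rewrite [LHS]coef_modpD d2 ?add0r ?coef_modpD // mdeg1.
Qed.

(** On the socle the constant coefficient already vanishes modulo p, so only the two linear ones
    decide membership; they account for the 2 in [k + 2]. *)
Lemma soc_p_xy2E :
  soc_p_xy2 b = soc b `&` [set v | forall i, coef_modp p U_(i) (lift v) = 0].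
Proof.
apply/seteqP; split=> v [sv hv]; split=> //=.
  by move=> i; move: hv; rewrite -{1}[v]liftK => /gen_p_xy2P; apply; rewrite mdeg1.
rewrite -[v]liftK; apply/gen_p_xy2P/ord_ge2P => //; exact: soc_lift_ord_ge1.
Qed.

Lemma Fp_dim_soc k : Fp_dim p (soc_p_xy2 b) k ->
  exists2 s, Fp_dim p (soc b) s & (k <= s <= k + 2)%N.
Proof.
rewrite soc_p_xy2E; apply: Fp_dim_ker => // [|i]; first exact: soc_subspace.
exact: coef_modp_liftD.
Qed.

(** Three functionals with common kernel 0: [Fp_dim_ker] with [k := 0] yields both the existence of
    the dimension and the bound 3. *)
Lemma Fp_dim_soc_p_xy2 nu : minimal_generating [set` b] nu ->
  exists2 k, Fp_dim p (soc_p_xy2 b) k & (k <= 3)%N.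
Proof.
move=> [bI _ nuD nu0 nu_soc].
have gb v (i : 'I_3) : soc b v -> [set` b] (gens`_i * repr v).
  rewrite -{1}[v]reprK => /socP; rewrite mulrC; apply; exact: gens_Pmax.
have nu_add (i : 'I_3) : additive_on (soc_p_xy2 b) (fun v => nu (gens`_i * repr v)).
  move=> v w [sv _] [sw _]; have [_ bD _] := bI.
  rewrite -nuD -?mulrDr; do ?exact: gb.
  (* Representatives add up only modulo [b]; the defect times a generator lies in b(p,x,y), where
     [nu] vanishes. *)
  rewrite -[repr (v + w)](subrK (repr v + repr w)).
  set d := _ - _; have bd : [set` b] d.
    by apply/piB_eq0; rewrite /d !(rmorphB, rmorphD) /= !reprK subrr.
  have bmd : idealM [set` b] Pmax (gens`_i * d).
    rewrite mulrC; apply: sub_ideal_gen; exists d => //.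
    by exists gens`_i => //; apply: gens_Pmax.
  have bgd : [set` b] (gens`_i * d) by case: bI => _ _; apply.
  have bgvw : [set` b] (gens`_i * (repr v + repr w)).
    by rewrite mulrDr; apply: bD; apply: gb.
  by rewrite [in LHS]mulrDr (nuD _ _ bgd bgvw) (nu0 _ bmd) add0r.
have [|k hk k3] := Fp_dim_ker (k := 0) soc_p_xy2_subspace nu_add; last by exists k.
(* The common kernel is trivial by the third condition on a minimal generating pair. *)
rewrite (_ : _ `&` _ = [set 0]); first exact: Fp_dim0.
apply/seteqP; split=> [v [[sv gv] /= nuv]|v -> /=].
  have v2 : p_xy2 p Px Py (repr v).
    rewrite p_xy2E -[repr v]reprK; exists (lift v) => //.
    by apply/gen_p_xy2P; rewrite liftK.
  rewrite -[v]reprK; apply/piB_eq0.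
  case: (nu_soc _ v2) => [m hm|//|]; first by move: m hm; apply/socP; rewrite reprK.
  by case; [have := nuv ord0|have := nuv (@Ordinal 3 1 isT)|have := nuv (@Ordinal 3 2 isT)];
    move=> /= ->; rewrite eqxx.
split; first by case: soc_p_xy2_subspace.
by move=> i; apply: additive_on0 (nu_add i); apply: soc_p_xy2_subspace.
Qed.

Lemma idealColon_idealM nu : minimal_generating [set` b] nu ->
  idealColon (idealM [set` b] Pmax) Pmax = [set` b].
Proof.
move=> [[b0 bD bM] _ _ nu0 nu_soc]; apply/seteqP; split=> [r hr|r br s hs]; last first.
  by apply: sub_ideal_gen; exists r => //; exists s.
have g (i : 'I_3) : idealM [set` b] Pmax (r * gens`_i).
  by apply: hr; apply: gens_Pmax.
have bm_sub : idealM [set` b] Pmax `<=` [set` b].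
  apply: (ideal_gen_min idealr_is_ideal) => _ [u bu [m _ <-]].
  by rewrite mulrC; apply: bM.
have bm_ord : idealM [set` b] Pmax `<=` Pord_ge 3.
  apply: (ideal_gen_min (Pord_ge_is_ideal _ _ 3)).
  move=> _ [u /b_ord u2 [m /Pmax_Pord_ge m1 <-]]; exact: (Pord_geM u2 m1).
have r2 : p_xy2 p Px Py r.
  (* Cancelling x from order 3 to order 2 requires order 3 to be well defined in P, which is exactly
     [3 <= n]. *)
  rewrite p_xy2E; apply: (Pord_geXM n_ge3); apply: bm_ord.
  exact: (g (@Ordinal 3 1 isT)).
case: (nu_soc r r2) => [m /hr/bm_sub //|//|].
by case; rewrite mulrC nu0 ?eqxx //; [exact: (g ord0)|exact: (g (@Ordinal 3 1 isT))
  |exact: (g (@Ordinal 3 2 isT))].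
Qed.

End SocleOfQuotient.

Theorem proposition4p10 (p n : nat) (p_pr : prime p) (n_ge3 : (3 <= n)%N)
    (b : idealr (truncZxy p_pr n_ge3))
    (hb : exists nu : truncZxy p_pr n_ge3 -> 'F_p,
        minimal_generating [set` b] nu) :
  exists k s : nat,
    [/\ Fp_dim p (soc_p_xy2 b) k,
        Fp_dim p (soc b) s,
        (k <= 3)%N,
        (k <= s <= k + 2)%N
      & idealColon (idealM [set` b] (Pmax p_pr n_ge3)) (Pmax p_pr n_ge3) = [set` b]].
Proof.
case: hb => nu hnu; have b_ord : [set` b] `<=` @Pord_ge p n p_pr n_ge3 2.
  by rewrite -p_xy2E; case: hnu => _ [].
have [k hk k3] := Fp_dim_soc_p_xy2 b_ord hnu.
have [s hs ks] := Fp_dim_soc b_ord hk.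
by exists k, s; split=> //; apply: idealColon_idealM hnu.
Qed.
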